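(* For every integer $n \geq 2$, if $K_n$ is the complete graph of order $n$, then $d(K_n) = n-1$.
   Context: Graphs are finite and simple. The deduction game on a graph $G$: a layout is a placement of searchers on vertices of $G$ (a vertex may receive several searchers). A vertex is occupied in the layout if it contains at least one searcher, and unoccupied otherwise. A vertex is protected if it is occupied in the initial layout or if a searcher has moved there at some point, and unprotected otherwise. A vertex is fireable if the number of searchers on it is greater than or equal to the number of its unprotected neighbours. Initially every searcher is mobile; once a searcher has moved once, it becomes immobile (cannot move again). At each stage, simultaneously, for every fireable vertex $v$ containing mobile searchers, one searcher moves from $v$ to each unprotected neighbour of $v$ (excess searchers stay on $v$; several fireable vertices may send a searcher to the same target). Stages continue until no new searchers move. The layout is successful if at the end all vertices of $G$ are protected. The deduction number $d(G)$ is the minimum number of searchers in a successful layout on $G$. *)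

(* Defs.v *)
From mathcomp Require Import all_boot.

Set Implicit Arguments.
Unset Strict Implicit.
Unset Printing Implicit Defensive.

Record sgraph := SGraph {
  vertex :> finType;
  adj : rel vertex;
  adj_sym : symmetric adj;
  adj_irrefl : irreflexive adj }.

Section DeductionGame.
Variable G : sgraph.

(* Searchers standing on the same vertex with the same mobility status are
   interchangeable, so a position of the game only records how many there are. *)
Record state := State {
  mobile : {ffun G -> nat};
  immobile : {ffun G -> nat};
  protected : {set G} }.

Definition searchers (s : state) (v : G) : nat := mobile s v + immobile s v.

Definition unprotected_nbrs (s : state) (v : G) : {set G} :=
  [set w | adj v w & w \notin protected s].

Definition fireable (s : state) (v : G) : bool :=
  #|unprotected_nbrs s v| <= searchers s v.

(* In the next stage a searcher moves from v to w. *)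
Definition moves (s : state) (v w : G) : bool :=
  [&& 0 < mobile s v, fireable s v & w \in unprotected_nbrs s v].

(* The subtraction never truncates in an actual game: see run_mobile. *)
Definition stage (s : state) : state := {|
  mobile := [ffun v => mobile s v - #|[set w | moves s v w]|];
  immobile := [ffun w => immobile s w + #|[set v | moves s v w]|];
  protected := protected s :|: [set w | [exists v, moves s v w]] |}.

Definition terminal (s : state) : bool := [forall v, forall w, ~~ moves s v w].

(* A layout of k searchers sends each searcher to its initial vertex. *)
Definition layout (k : nat) := {ffun 'I_k -> G}.

Definition start k (L : layout k) : state := {|
  mobile := [ffun v => #|[set i | L i == v]|];
  immobile := [ffun=> 0];
  protected := [set v | [exists i, L i == v]] |}.

Definition run k (L : layout k) (t : nat) : state := iter t stage (start L).

(* Every stage with a move protects a new vertex, so the game is over after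
   #|G| stages: see outcome_terminal and run_outcome. *)
Definition outcome k (L : layout k) : state := run L #|G|.

Definition successful k (L : layout k) : bool :=
  protected (outcome L) == [set: G].

Lemma run_mobile k (L : layout k) t v :
  #|[set w | moves (run L t) v w]| <= mobile (run L t) v.
Proof.
have inv : forall u, 0 < mobile (run L t) u ->
    u \in protected (run L t) /\ immobile (run L t) u = 0.
  elim: t => [|t IH] u.
    rewrite !ffunE card_gt0 => /set0Pn[i]; rewrite inE => Li.
    by split=> //; rewrite inE; apply/existsP; exists i.
  rewrite /run iterS -/(run L t) /= !ffunE => mu.
  have [pu iu] := IH u (leq_trans mu (leq_subr _ _)).
  rewrite inE pu iu; split=> //.
  by apply: eq_card0 => w; rewrite !inE /moves inE pu !andbF.
have [->|[w vw]] := set_0Vmem [set w | moves (run L t) v w].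
  by rewrite cards0.
move: vw; rewrite inE => /and3P[mv fv _].
have [_ iv] := inv v mv.
move: fv; rewrite /fireable /searchers iv addn0; apply: leq_trans.
by apply/subset_leq_card/subsetP => x; rewrite inE => /and3P[].
Qed.

Lemma stage_terminal s : terminal s -> stage s = s.
Proof.
move=> /forallP ts; have mF v w : moves s v w = false.
  by apply: negbTE; apply: (forallP (ts v)).
case: s ts mF => m i p ts mF; congr State => /=.
- apply/ffunP => v; rewrite ffunE (_ : [set _ | _] = set0) ?cards0 ?subn0 //.
  by apply/setP => w; rewrite !inE mF.
- apply/ffunP => v; rewrite ffunE (_ : [set _ | _] = set0) ?cards0 ?addn0 //.
  by apply/setP => w; rewrite !inE mF.
- apply/setP => w; rewrite !inE; case: existsP => [[v]|_]; last by rewrite orbF.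
  by rewrite mF.
Qed.

Lemma outcome_terminal k (L : layout k) : terminal (outcome L).
Proof.
have step t : terminal (run L t) || (t <= #|protected (run L t)|).
  elim: t => [|t IH]; first by rewrite orbT.
  have [tt|ntt] := boolP (terminal (run L t)).
    by rewrite /run iterS -/(run L t) (stage_terminal tt) tt.
  rewrite (negbTE ntt) /= in IH; apply/orP; right; apply: leq_ltn_trans IH _.
  rewrite /run iterS -/(run L t); apply: proper_card; apply/properP.
  split; first exact: subsetUl.
  move: ntt; rewrite negb_forall => /existsP[v]; rewrite negb_forall.
  move=> /existsP[w /negPn vw]; exists w.
    by rewrite !inE; apply/orP; right; apply/existsP; exists v.
  by case/and3P: vw => _ _; rewrite inE => /andP[].
have /orP[//|full] := step #|G|.
have pT : protected (outcome L) = [set: G].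
  by apply/eqP; rewrite eqEcard subsetT cardsT.
apply/forallP => v; apply/forallP => w.
by rewrite /moves inE pT inE !andbF.
Qed.

Lemma run_outcome k (L : layout k) t : #|G| <= t -> run L t = outcome L.
Proof.
move=> /subnK <-; elim: (t - _) => [|m IH] //.
by rewrite addSn /run iterS -/(run L _) IH stage_terminal ?outcome_terminal.
Qed.

Lemma successful_exists : exists k, [exists L : layout k, successful L].
Proof.
exists #|G|; apply/existsP; exists [ffun i => enum_val i].
have sub t : protected (run [ffun i : 'I_#|G| => enum_val i] t) = [set: G].
  elim: t => [|t IH]; last by rewrite /run iterS /= -/(run _ t) IH setTU.
  apply/setP => v; rewrite !inE; apply/existsP; exists (enum_rank v).
  by rewrite ffunE enum_rankK.
by apply/eqP/sub.
Qed.

Definition deduction_number : nat := ex_minn successful_exists.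

End DeductionGame.

Section Complete.
Variable n : nat.

Definition complete_adj : rel 'I_n := fun x y => x != y.

Lemma complete_sym : symmetric complete_adj.
Proof. by move=> x y; rewrite /complete_adj eq_sym. Qed.

Lemma complete_irrefl : irreflexive complete_adj.
Proof. by move=> x; rewrite /complete_adj eqxx. Qed.

Definition complete_graph : sgraph := SGraph complete_sym complete_irrefl.

End Complete.

(* Main.v *)
Require Import Defs.
From mathcomp Require Import all_boot.

(** A game can only make progress if some vertex v sends out searchers in the
    very first stage.  At that moment the searchers standing on v are at least
    as many as the unoccupied neighbours of v, while each occupied neighbour
    accounts for a further searcher of its own, so there are at least deg v
    searchers in all ([move_start_degree]).  Thus a successful layout either
    already occupies every vertex or has at least as many searchers as the
    minimum degree ([successful_degree]); in the complete graph of order n both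
    alternatives give at least n - 1 searchers.  Conversely, a nonempty pile of
    n - 1 searchers on one vertex that is adjacent to all the others protects
    everything in a single stage ([universal_successful]). *)

Section Bounds.
Variables (G : sgraph) (k : nat).
Implicit Types (L : layout G k) (v : G).

Lemma protected_outcome L t :
  t <= #|G| -> protected (run L t) \subset protected (outcome L).
Proof.
move=> /subnKC; rewrite /outcome => <-; elim: (#|G| - t) => [|m IH].
  by rewrite addn0.
by rewrite addnS /run iterS; apply: subset_trans IH (subsetUl _ _).
Qed.

(** The neighbours of v split into the unprotected ones, paid for by the
    searchers on v because v is fireable, and the occupied ones, paid for by
    the searchers elsewhere. *)
Lemma move_start_degree L v w :
  moves (start L) v w -> #|[set u | adj v u]| <= k.
Proof.
case/and3P=> _ fire_v _.
have unprot_le : #|unprotected_nbrs (start L) v| <= #|[set i | L i == v]|.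
  by move: fire_v; rewrite /fireable /searchers !ffunE addn0.
have occ_le : #|[set u | adj v u] :&: protected (start L)|
              <= #|~: [set i | L i == v]|.
  apply: leq_trans (leq_imset_card L _).
  apply/subset_leq_card/subsetP => u; rewrite !inE => /andP[vu /existsP[i Li]].
  rewrite -(eqP Li); apply: imset_f; rewrite !inE.
  by apply/eqP => Liv; rewrite -(eqP Li) Liv adj_irrefl in vu.
rewrite -(cardsID (protected (start L))) -[k in _ <= k]card_ord.
rewrite -(cardsC [set i | L i == v]) addnC; apply: leq_add occ_le.
apply: leq_trans unprot_le; apply/subset_leq_card/subsetP => u.
by rewrite !inE andbC.
Qed.

(** If nothing moves in the first stage, then nothing ever moves, and the
    protected vertices are the ones occupied from the start. *)
Lemma successful_degree L :
  successful L -> #|G| <= k \/ exists v, #|[set u | adj v u]| <= k.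
Proof.
move=> succ_L; have [term_L|] := boolP (terminal (start L)).
  left; have run_start t : run L t = start L.
    by elim: t => [|t IH] //; rewrite /run iterS -/(run L t) IH stage_terminal.
  move: succ_L; rewrite /successful /outcome run_start => /eqP occ_all.
  rewrite -cardsT -occ_all -[k in _ <= k]card_ord -cardsT.
  apply: leq_trans (leq_imset_card L _).
  apply/subset_leq_card/subsetP => v; rewrite inE => /existsP[i /eqP <-].
  by apply: imset_f; rewrite inE.
rewrite negb_forall => /existsP[v]; rewrite negb_forall => /existsP[w].
by move/negPn/move_start_degree; right; exists v.
Qed.

Lemma universal_successful v :
  (forall w, w != v -> adj v w) -> 0 < k -> #|G|.-1 <= k ->
  successful ([ffun=> v] : layout G k).
Proof.
move=> univ_v k_gt0 le_k; set L := [ffun=> v].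
have searchers_v : #|[set i | L i == v]| = k.
  rewrite -[RHS]card_ord -cardsT.
  by apply: eq_card => i; rewrite !inE ffunE eqxx.
have G_gt0 : 0 < #|G| by apply/card_gt0P; exists v.
rewrite /successful -subTset; apply: subset_trans (protected_outcome L _ G_gt0).
apply/subsetP => w _; rewrite /= in_setU; have [//|w_unprot] := boolP (w \in _).
have vw : w != v.
  apply: contraNneq w_unprot => ->; rewrite inE; apply/existsP.
  by exists (Ordinal k_gt0); rewrite ffunE.
rewrite inE; apply/existsP; exists v; apply/and3P; split.
- by rewrite ffunE searchers_v.
- rewrite /fireable /searchers !ffunE addn0 searchers_v.
  apply: leq_trans le_k; rewrite -(cardC1 v); apply/subset_leq_card/subsetP => u.
  rewrite !inE => /andP[vu _]; apply: contraTneq vu => ->.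
  by rewrite adj_irrefl.
- by rewrite inE univ_v.
Qed.

End Bounds.

Theorem theorem4p4 (n : nat) (hn : 2 <= n) :
  deduction_number (complete_graph n) = n - 1.
Proof.
have card_K : #|complete_graph n| = n by rewrite card_ord.
have degree_K (v : complete_graph n) : #|[set u | adj v u]| = n.-1.
  rewrite -[in RHS]card_K -(cardC1 v).
  by apply: eq_card => u; rewrite !inE eq_sym.
rewrite subn1 /deduction_number; case: ex_minnP => k /existsP[L succ_L] min_k.
apply/eqP; rewrite eqn_leq; apply/andP; split; last first.
  case: (successful_degree _ _ _ succ_L) => [|[v]]; last by rewrite degree_K.
  by rewrite card_K; apply: leq_trans (leq_pred n).
have v : complete_graph n := Ordinal (ltnW hn).
apply: min_k; apply/existsP; exists [ffun=> v].
apply: universal_successful; last by rewrite card_K.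
- by move=> w; rewrite eq_sym.
- by rewrite -ltnS prednK // ltnW.
Qed.
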